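(* Let $d:\{0,1\}^n\to\mathbb{R}_+$ be a non-decreasing submodular demand realization, and for an order quantity $q\in\mathbb{R}^n$, $q\ge0$, let $s_q(x)=q^\intercal x$ for $x\in\{0,1\}^n$. For a given price vector $p\in\mathbb{R}^n_+$ with $p_1\ge p_2\ge\dots\ge p_n$, we have $$R(p\mid q,d)=\langle\mu^*,p\rangle,$$ where $\mu^*=(\mu_1^*,\dots,\mu_n^* )$ is obtained recursively as follows: $\beta^0=\mathbf 0$, $v_0=\mathbf 0$, and for $t=1,\dots,n$, $$\mu_t^*=\min_{y\in\{0,1\}^n}\bigl\{g(e_t+y)-\langle\beta^{t-1},y\rangle\ \bigm|\ y\le v_{t-1},\ e_t+y\in\{0,1\}^n\bigr\},\qquad\beta^t=\beta^{t-1}+\mu_t^*e_t,\quad v_t=v_{t-1}+e_t,$$ with $g:\{0,1\}^n\to\mathbb{R}$ given by $g(x)=\min\{d(x),q^\intercal x\}$ if $x\in\{e_i\mid i\in[n]\}$ and $g(x)=d(x)$ otherwise.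
   Context: $[n]=\{1,\dots,n\}$, $e_i$ is the $i$-th standard basis vector. Non-decreasing means $d(x)\le d(x')$ whenever $x\le x'$ componentwise. Submodular on $\{0,1\}^n$ means $d(x)+d(y)\ge d(x\vee y)+d(x\wedge y)$ with componentwise max and min. The revenue function is $$R(p\mid q,d):=\max\bigl\{p^\intercal y\bigm|y\in\mathbb{R}^n,\ y\ge0,\ y^\intercal x\le\min\{d(x),s_q(x)\}\text{ for all }x\in\{0,1\}^n\bigr\}.$$ *)

(* Defs.v *)
From HB Require Import structures.
From mathcomp Require Import all_boot all_order all_algebra.
From mathcomp Require Import boolp classical_sets reals.

Set Implicit Arguments.
Unset Strict Implicit.
Unset Printing Implicit Defensive.

Import Order.TTheory GRing.Theory Num.Theory.

Local Open Scope classical_set_scope.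
Local Open Scope ring_scope.

(* {0,1}^n: the product order on boolean tuples is the componentwise order, so
   (x `|` y)%O and (x `&` y)%O are the componentwise max and min, and
   \bot%O is the zero vector.  Coordinates are numbered from 0 to n-1. *)
Definition cube (n : nat) := n.-tupleprod bool.

Definition unit_cube (n : nat) (i : 'I_n) : cube n := [tuple j == i | j < n].

Definition vec_of_cube (R : realType) (n : nat) (x : cube n) : 'rV[R]_n :=
  \row_i (tnth x i)%:R.

Definition dotp (R : realType) (n : nat) (u v : 'rV[R]_n) : R :=
  \sum_(i < n) u 0 i * v 0 i.

(* x + y belongs to {0,1}^n exactly when the supports are disjoint, in which
   case it is the join; see addable_cubeP and vec_of_add_cube. *)
Definition addable_cube (n : nat) (x y : cube n) : bool :=
  ((x `&` y)%O == \bot%O).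
Definition add_cube (n : nat) (x y : cube n) : cube n := (x `|` y)%O.

Definition nondecreasing_cube (R : realType) (n : nat) (d : cube n -> R) : Prop :=
  forall x y : cube n, (x <= y)%O -> d x <= d y.

Definition submodular_cube (R : realType) (n : nat) (d : cube n -> R) : Prop :=
  forall x y : cube n, d (x `|` y)%O + d (x `&` y)%O <= d x + d y.

Section Revenue.
Variables (R : realType) (n : nat).
Implicit Types (p q y : 'rV[R]_n) (d : cube n -> R).

Definition supply q (x : cube n) : R := dotp q (vec_of_cube R x).

Definition feasible q d : set 'rV[R]_n :=
  [set y : 'rV[R]_n | (forall i, 0 <= y 0 i) /\
           (forall x : cube n,
              dotp y (vec_of_cube R x) <= Num.min (d x) (supply q x))].

Definition revenues p q d : set R := dotp p @` feasible q d.

Definition is_max (A : set R) : set R := [set r | A r /\ ubound A r].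

(* The maximum of [revenues p q d]; the value 0 is a placeholder for the case
   where no maximum exists. *)
Definition revenue p q d : R := xget 0 (is_max (revenues p q d)).

Definition gfun q d (x : cube n) : R :=
  if [exists i : 'I_n, x == unit_cube i] then Num.min (d x) (supply q x)
  else d x.

Definition mu_objective q d (t : 'I_n) (beta : 'rV[R]_n) (y : cube n) : R :=
  gfun q d (add_cube (unit_cube t) y) - dotp beta (vec_of_cube R y).

(* y = \bot always satisfies the constraints, so that taking its objective
   value as the default of the iterated minimum does not change the minimum. *)
Definition mu_step q d (t : 'I_n) (beta : 'rV[R]_n) (v : cube n) : R :=
  \big[Num.min/mu_objective q d t beta \bot%O]_
     (y : cube n | (y <= v)%O && addable_cube (unit_cube t) y)
     mu_objective q d t beta y.

(* The pair (beta^k, v_k).  The coordinate indexed by t : 'I_n is treated in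
   the step from k = t to k = t + 1; see greedy_ordS. *)
Fixpoint greedy q d (k : nat) : 'rV[R]_n * cube n :=
  if k is k'.+1 then
    let: (beta, v) := greedy q d k' in
    if (insub k' : option 'I_n) is Some t then
      (beta + mu_step q d t beta v *: delta_mx 0 t, add_cube v (unit_cube t))
    else (beta, v)
  else (0, \bot%O).

Definition mu_star q d : 'rV[R]_n :=
  \row_t mu_step q d t (greedy q d t).1 (greedy q d t).2.

Lemma greedy_ordS q d (t : 'I_n) :
  greedy q d t.+1 =
    ((greedy q d t).1 + mu_star q d 0 t *: delta_mx 0 t,
     add_cube (greedy q d t).2 (unit_cube t)).
Proof.
rewrite /= mxE; case: (greedy q d t) => beta v /=.
by rewrite valK.
Qed.

Lemma vec_of_add_cube (x y : cube n) : addable_cube x y ->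
  vec_of_cube R (add_cube x y) = vec_of_cube R x + vec_of_cube R y.
Proof.
move=> /eqP xy; apply/rowP => i; rewrite !mxE.
have : tnth (x `&` y)%O i = false by rewrite xy tnth_mktuple.
rewrite !tnth_mktuple.
by case: (tnth x i); case: (tnth y i); rewrite ?addr0 ?add0r.
Qed.

Lemma addable_cubeP (x y : cube n) :
  addable_cube x y <->
  exists z : cube n, vec_of_cube R z = vec_of_cube R x + vec_of_cube R y.
Proof.
split=> [xy|[z zE]]; first by exists (add_cube x y); exact: vec_of_add_cube.
apply/eqP/eq_from_tnth => i; rewrite !tnth_mktuple.
move/rowP: zE => /(_ i); rewrite !mxE.
case: (tnth x i); case: (tnth y i) => //= /eqP.
by case: (tnth z i); rewrite -natrD eqr_nat.
Qed.

End Revenue.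

(* Main.v *)
Require Import Defs.
From mathcomp Require Import all_boot all_order all_algebra.
From mathcomp Require Import boolp classical_sets reals.
From mathcomp Require Import lra.
Import Order.TTheory GRing.Theory Num.Theory.
Local Open Scope ring_scope.

(** The feasible set is the polymatroid cut out by [y(S) <= d(S)] together with
    the box [y <= q], where [y(S)] is the sum of the entries of [y] over the
    support [S] of a vertex of the cube; the supply constraints on larger
    vertices add nothing to those on unit vectors.  Step [t] raises coordinate
    [t] of the greedy vector [mu] as far as the constraints supported on the
    coordinates up to [t] permit.

    Each nonempty [S] is controlled by the step of its largest index, hence
    [mu] is feasible ([mu_star_feasible]); monotonicity of [d] keeps the
    increments nonnegative.  As step [t] stops at a binding constraint, either
    [mu_t = q_t] or [t] is the largest index of a tight set, one with
    [mu(S) = d(S)] ([mu_star_tight]).  By submodularity tight sets are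
    closed under union, so each prefix of the coordinates splits into an empty
    or tight set and indices saturated by [q] ([prefix_decomposition]).  Adding
    up the corresponding constraints on a feasible [y] shows that [mu]
    maximizes all prefix sums simultaneously ([prefix_sum_le]).  A
    nonincreasing nonnegative price vector is a nonnegative combination of
    indicators of prefixes, which is the summation by parts of
    [sum_by_parts_le]; hence [mu] maximizes the revenue. *)

(** * Vertices of the cube and partial sums *)

Definition cube_sum {R : realType} {n : nat} (u : 'rV[R]_n) (x : cube n) : R :=
  \sum_(i < n | tnth x i) u 0 i.

Definition prefix_cube (n k : nat) : cube n := [tuple (i < k)%N | i < n].

Section Cube.
Context {n : nat}.
Implicit Types (x y : cube n) (i j : 'I_n).

Lemma tnth_join x y i : tnth (x `|` y)%O i = tnth x i || tnth y i.
Proof. by rewrite tnth_mktuple. Qed.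

Lemma tnth_meet x y i : tnth (x `&` y)%O i = tnth x i && tnth y i.
Proof. by rewrite tnth_mktuple. Qed.

Lemma tnth_bot i : tnth (\bot%O : cube n) i = false.
Proof. by rewrite tnth_mktuple. Qed.

Lemma tnth_unit i j : tnth (unit_cube i) j = (j == i).
Proof. by rewrite tnth_mktuple. Qed.

Lemma tnth_prefix k i : tnth (prefix_cube n k) i = (i < k)%N.
Proof. by rewrite tnth_mktuple. Qed.

Lemma le_cubeP x y :
  reflect (forall i, tnth x i -> tnth y i) (x <= y)%O.
Proof.
rewrite leEtprod.
by apply: (iffP forallP) => h i; have := h i;
  case: (tnth x i); case: (tnth y i) => // ->.
Qed.

Lemma cube_neq0 x : x != \bot%O -> exists i, tnth x i.
Proof.
move=> x0; apply/existsP; apply: contraNT x0 => /existsPn x0.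
by apply/eqP/eq_from_tnth => i; rewrite tnth_bot; apply/negbTE/x0.
Qed.

Context {R : realType}.
Implicit Type u : 'rV[R]_n.

Lemma dotp_cube u x : dotp u (vec_of_cube R x) = cube_sum u x.
Proof.
rewrite /dotp /cube_sum [RHS]big_mkcond; apply: eq_bigr => i _; rewrite mxE.
by case: (tnth x i); rewrite ?mulr1 ?mulr0.
Qed.

Lemma cube_sum0 u : cube_sum u (\bot%O : cube n) = 0.
Proof. by rewrite /cube_sum big_pred0// => i; rewrite tnth_bot. Qed.

Lemma cube_sum_unit u i : cube_sum u (unit_cube i) = u 0 i.
Proof.
by rewrite /cube_sum (big_pred1 i)// => j; rewrite /= tnth_unit.
Qed.

Lemma cube_sum_modular u x y :
  cube_sum u (x `|` y)%O + cube_sum u (x `&` y)%O = cube_sum u x + cube_sum u y.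
Proof.
rewrite /cube_sum !(big_mkcond (fun i : 'I_n => tnth _ i)) -!big_split.
apply: eq_bigr => i _ /=; rewrite tnth_join tnth_meet.
by case: (tnth x i); case: (tnth y i); rewrite ?addr0 ?add0r.
Qed.

Lemma cube_sum_disjoint u x y : (forall i, tnth x i -> ~~ tnth y i) ->
  cube_sum u (x `|` y)%O = cube_sum u x + cube_sum u y.
Proof.
move=> xy; rewrite -cube_sum_modular.
suff -> : (x `&` y)%O = \bot%O by rewrite cube_sum0 addr0.
apply: eq_from_tnth => i; rewrite tnth_meet tnth_bot; apply/negbTE.
by apply/andP => -[/xy/negbTE->].
Qed.

Lemma prefix_cubeS (i : 'I_n) :
  prefix_cube n i.+1 = (prefix_cube n i `|` unit_cube i)%O.
Proof.
apply: eq_from_tnth => j.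
by rewrite tnth_join !tnth_prefix tnth_unit ltnS leq_eqVlt orbC.
Qed.

Lemma prefix_cube0 : prefix_cube n 0 = \bot%O.
Proof. by apply: eq_from_tnth => i; rewrite !tnth_mktuple. Qed.

Lemma cube_sum_prefixS u (i : 'I_n) :
  cube_sum u (prefix_cube n i.+1) = cube_sum u (prefix_cube n i) + u 0 i.
Proof.
rewrite prefix_cubeS cube_sum_disjoint ?cube_sum_unit// => j.
by rewrite tnth_prefix tnth_unit => /ltn_eqF ji; rewrite -val_eqE /= ji.
Qed.

End Cube.

(** Summation by parts: any common lower bound [c] of the weights can replace
    them all, because lowering every weight to the last one only discards
    nonnegative multiples of prefix sums.  The general [c], rather than [0],
    is what makes the induction on the length go through. *)
Lemma sum_by_parts_le (R : realType) (n : nat) (w a : 'I_n -> R) (c : R) :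
  (forall i j : 'I_n, (i <= j)%N -> w j <= w i) ->
  (forall k, 0 <= \sum_(i < n | (i < k)%N) a i) ->
  (forall i, c <= w i) ->
  c * \sum_(i < n) a i <= \sum_(i < n) w i * a i.
Proof.
elim: n => [|n IHn] in w a c *; first by rewrite !big_ord0 mulr0.
move=> w_dec a_ge0 c_le.
have sum_ge0 : 0 <= \sum_(i < n.+1) a i.
  by have := a_ge0 n.+1; rewrite (eq_bigl xpredT)// => i; rewrite ltn_ord.
apply: le_trans (_ : w ord_max * \sum_(i < n.+1) a i <= _).
  by rewrite ler_wpM2r.
rewrite !big_ord_recr /= mulrDr lerD2r.
apply: IHn => [i j ij|k|i]; first exact: w_dec.
- have := a_ge0 (minn k n); rewrite big_mkcond big_ord_recr /=.
  rewrite ltnNge geq_minr addr0 -big_mkcond /=.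
  by under eq_bigl => i do rewrite leq_min ltn_ord andbT.
- by apply: w_dec; rewrite leq_ord.
Qed.

(** * The greedy vector *)

Section Greedy.
Context {R : realType} {n : nat}.
Variables (d : cube n -> R) (q : 'rV[R]_n).
Implicit Types (x y z A : cube n) (i j t : 'I_n) (u : 'rV[R]_n).

Let mu := mu_star q d.

Lemma greedyE k : (k <= n)%N ->
  greedy q d k = (\row_i (if (i < k)%N then mu 0 i else 0), prefix_cube n k).
Proof.
elim: k => [_|k IHk kn].
  by rewrite prefix_cube0; congr (_, _); apply/rowP => i; rewrite !mxE.
rewrite (greedy_ordS q d (Ordinal kn)) IHk ?(ltnW kn)//=.
rewrite (prefix_cubeS (Ordinal kn)); congr (_, _).
apply/rowP => i; rewrite !mxE eqxx -val_eqE /= (ltnS i) (leq_eqVlt i).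
have [ik|_] := eqVneq (i : nat) k; last by rewrite mulr0 addr0.
have -> : i = Ordinal kn by apply: val_inj.
by rewrite /= ltnn add0r mulr1.
Qed.

Definition step_value t y : R :=
  gfun q d (unit_cube t `|` y)%O - cube_sum mu y.

(** The recursion without its state: a vertex [y] supported below [t] is
    automatically addable to the unit vector of [t], and on such a [y] the
    accumulated vector agrees with the final one. *)
Lemma mu_starE t : mu 0 t =
  \big[Num.min/step_value t \bot%O]_(y : cube n | (y <= prefix_cube n t)%O)
     step_value t y.
Proof.
have objE y : (y <= prefix_cube n t)%O ->
    mu_objective q d t (\row_i (if (i < t)%N then mu 0 i else 0)) y =
    step_value t y.
  move=> /le_cubeP yt; rewrite /mu_objective /step_value dotp_cube.
  congr (_ - _); apply: eq_bigr => i /yt; rewrite tnth_prefix mxE.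
  by move->.
rewrite {1}/mu mxE greedyE ?(ltnW (ltn_ord t))//= /mu_step objE ?le0x//.
rewrite (eq_bigl (fun y => (y <= prefix_cube n t)%O)); last first.
  move=> y; case: (boolP (y <= _)%O) => //= /le_cubeP yt.
  apply/eqP/eq_from_tnth => i; rewrite tnth_meet tnth_bot tnth_unit.
  case: eqP => //= ->; apply/negbTE/negP => /yt.
  by rewrite tnth_prefix ltnn.
by apply: eq_bigr => y; exact: objE.
Qed.

Lemma mu_star_le t y : (y <= prefix_cube n t)%O -> mu 0 t <= step_value t y.
Proof. by move=> yt; rewrite mu_starE; apply: bigmin_le_cond. Qed.

Lemma mu_star_attained t :
  exists2 y, (y <= prefix_cube n t)%O & mu 0 t = step_value t y.
Proof.
rewrite mu_starE; elim/big_ind: _ => [|a b [y yt ->] [z zt ->]|y yt].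
- by exists \bot%O; rewrite ?le0x.
- by case: (leP (step_value t y) (step_value t z)) => _; [exists y|exists z].
- by exists y.
Qed.

Lemma cube_sum_step t y : (y <= prefix_cube n t)%O ->
  cube_sum mu (unit_cube t `|` y)%O = mu 0 t + cube_sum mu y.
Proof.
move=> /le_cubeP yt; rewrite cube_sum_disjoint ?cube_sum_unit// => i.
rewrite tnth_unit => /eqP ->; apply/negP => /yt.
by rewrite tnth_prefix ltnn.
Qed.

Lemma gfun_unit t : gfun q d (unit_cube t) = Num.min (d (unit_cube t)) (q 0 t).
Proof.
rewrite /gfun; case: existsP => [_|[]]; last by exists t.
by rewrite /supply dotp_cube cube_sum_unit.
Qed.

Lemma gfun_le x : gfun q d x <= d x.
Proof. by rewrite /gfun; case: ifP => // _; rewrite ge_min lexx. Qed.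

Lemma gfun_step t y : (y <= prefix_cube n t)%O -> y != \bot%O ->
  gfun q d (unit_cube t `|` y)%O = d (unit_cube t `|` y)%O.
Proof.
move=> /le_cubeP yt /cube_neq0[i yi]; rewrite /gfun; case: existsP => // -[j].
move=> /eqP E; have it := yt i yi; rewrite tnth_prefix in it.
have tj : t = j.
  by apply/eqP; rewrite -tnth_unit -E tnth_join tnth_unit eqxx.
have ij : i = j.
  by apply/eqP; rewrite -tnth_unit -E tnth_join yi orbT.
by move: it; rewrite ij tj ltnn.
Qed.

(** The binding constraint involves the largest index of [x], which plays the
    role of [t] in a step of the recursion with the rest of [x] as [y]. *)
Lemma cube_sum_mu_le x : x != \bot%O -> cube_sum mu x <= gfun q d x.
Proof.
move=> /cube_neq0[i0 xi0].
case: (@arg_maxnP _ i0 (fun i => tnth x i) val xi0) => t xt t_max.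
pose y : cube n := (x `&` prefix_cube n t)%O.
have yt : (y <= prefix_cube n t)%O by rewrite leIr.
have -> : x = (unit_cube t `|` y)%O.
  apply: eq_from_tnth => i; rewrite tnth_join tnth_meet tnth_unit tnth_prefix.
  have [->|it] := eqVneq i t; first by rewrite xt.
  case: (boolP (tnth x i)) => //= xi; symmetry.
  by rewrite ltn_neqAle val_eqE it /=; exact: t_max.
by rewrite cube_sum_step// -lerBrDr; exact: mu_star_le.
Qed.

Hypothesis d_ge0 : forall x, 0 <= d x.

Lemma cube_sum_mu_le_d x : cube_sum mu x <= d x.
Proof.
have [->|x0] := eqVneq x \bot%O; first by rewrite cube_sum0.
exact: le_trans (cube_sum_mu_le x x0) (gfun_le x).
Qed.

Lemma mu_star_le_q t : mu 0 t <= q 0 t.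
Proof.
have := @mu_star_le t \bot%O (le0x _).
rewrite /step_value cube_sum0 subr0 joinx0 gfun_unit.
by rewrite le_min => /andP[].
Qed.

Lemma mu_star_ge0 t : nondecreasing_cube d -> (forall i, 0 <= q 0 i) ->
  0 <= mu 0 t.
Proof.
move=> d_mono q_ge0; have [y yt ->] := mu_star_attained t.
rewrite /step_value; have [->|y0] := eqVneq y \bot%O.
  by rewrite cube_sum0 subr0 joinx0 gfun_unit le_min d_ge0 q_ge0.
rewrite gfun_step// subr_ge0.
by apply: le_trans (cube_sum_mu_le_d y) _; apply: d_mono; rewrite leUr.
Qed.

Lemma mu_star_feasible : nondecreasing_cube d -> (forall i, 0 <= q 0 i) ->
  feasible q d mu.
Proof.
move=> d_mono q_ge0; split=> [i|x]; first exact: mu_star_ge0.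
rewrite /supply !dotp_cube le_min cube_sum_mu_le_d /=.
by apply: ler_sum => i _; exact: mu_star_le_q.
Qed.

(** * Tight sets and optimality of prefix sums *)

Definition tight A := cube_sum mu A = d A.

(** A minimizer [y] of step [t] makes [t] together with [y] tight, except when
    [y] is zero and the value taken by the minimum is the supply [q_t]. *)
Lemma mu_star_tight t : mu 0 t = q 0 t \/
  exists A, [/\ tight A, tnth A t & (A <= prefix_cube n t.+1)%O].
Proof.
have [y yt mut] := mu_star_attained t.
have sum_eq :
    cube_sum mu (unit_cube t `|` y)%O = gfun q d (unit_cube t `|` y)%O.
  by rewrite cube_sum_step// mut /step_value subrK.
have A_t : tnth (unit_cube t `|` y)%O t by rewrite tnth_join tnth_unit eqxx.
have A_le : (unit_cube t `|` y <= prefix_cube n t.+1)%O.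
  by rewrite prefix_cubeS joinC leU2.
have [y0|y0] := eqVneq y \bot%O; last first.
  right; exists (unit_cube t `|` y)%O; split=> //.
  by rewrite /tight sum_eq gfun_step.
rewrite y0 joinx0 in sum_eq A_t A_le; rewrite gfun_unit in sum_eq.
case: (leP (d (unit_cube t)) (q 0 t)) sum_eq => _ sum_eq.
  by right; exists (unit_cube t).
by left; rewrite -sum_eq cube_sum_unit.
Qed.

Hypothesis d_submod : submodular_cube d.

(** Submodularity of [d] against modularity of [mu]: the slack of the union
    and that of the intersection are nonnegative with sum at most zero. *)
Lemma tight_join A B : tight A -> tight B -> tight (A `|` B)%O.
Proof.
rewrite /tight => tA tB; have := d_submod A B; have := cube_sum_modular mu A B.
have := cube_sum_mu_le_d (A `|` B)%O; have := cube_sum_mu_le_d (A `&` B)%O.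
by rewrite tA tB; lra.
Qed.

(** The zero vector is allowed beside the tight ones because [d] need not
    vanish at zero, so that zero itself may fail to be tight. *)
Lemma prefix_decomposition k : (k <= n)%N ->
  exists A, [/\ A = \bot%O \/ tight A, (A <= prefix_cube n k)%O &
    forall i, (i < k)%N -> ~~ tnth A i -> mu 0 i = q 0 i].
Proof.
elim: k => [_|k IHk kn]; first by exists \bot%O; rewrite le0x; split=> //; left.
have [A [tA Ak Aq]] := IHk (ltnW kn).
pose t := Ordinal kn.
have prefix_le : (prefix_cube n k <= prefix_cube n k.+1)%O.
  by rewrite (prefix_cubeS t) leUl.
have [qt|[B [tB Bt Bk]]] := mu_star_tight t.
  exists A; split=> // [|i]; first exact: le_trans prefix_le.
  rewrite ltnS leq_eqVlt => /orP[/eqP ik|ik]; last exact: Aq.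
  by have -> : i = t by apply: val_inj.
exists (A `|` B)%O; split.
- right; case: tA => [->|tA]; first by rewrite join0x.
  exact: tight_join.
- by rewrite leUx Bk (le_trans Ak).
- move=> i; rewrite tnth_join negb_or ltnS leq_eqVlt.
  move=> /orP[/eqP ik|ik] /andP[nA nB]; last exact: Aq.
  have it : i = t by apply: val_inj.
  by rewrite it Bt in nB.
Qed.

Lemma prefix_sum_le (y : 'rV[R]_n) k : feasible q d y -> (k <= n)%N ->
  cube_sum y (prefix_cube n k) <= cube_sum mu (prefix_cube n k).
Proof.
move=> [_ y_le] kn.
have [A [tA /le_cubeP Ak Aq]] := prefix_decomposition k kn.
have splitA u : cube_sum u (prefix_cube n k) =
    cube_sum u A + \sum_(i < n | (i < k)%N && ~~ tnth A i) u 0 i.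
  rewrite /cube_sum (bigID (fun i => tnth A i)) /=; congr (_ + _).
    apply: eq_bigl => i; rewrite tnth_prefix.
    by case: (boolP (tnth A i)) => [/Ak|]; rewrite ?andbF// tnth_prefix => ->.
  by apply: eq_bigl => i; rewrite tnth_prefix.
have y_le_d x : cube_sum y x <= d x.
  by have := y_le x; rewrite dotp_cube le_min => /andP[].
have y_le_q i : y 0 i <= q 0 i.
  have := y_le (unit_cube i).
  by rewrite /supply !dotp_cube !cube_sum_unit le_min => /andP[].
rewrite !splitA; apply: lerD.
  by case: tA => [->|->]; rewrite ?cube_sum0 ?y_le_d.
by apply: ler_sum => i /andP[ik nA]; rewrite (Aq i ik nA).
Qed.

Lemma mu_star_optimal (p y : 'rV[R]_n) : (forall i, 0 <= p 0 i) ->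
  (forall i j, (i <= j)%N -> p 0 j <= p 0 i) ->
  feasible q d y -> dotp p y <= dotp p mu.
Proof.
move=> p_ge0 p_dec yF; rewrite -subr_ge0 /dotp -sumrB;
under eq_bigr do rewrite -mulrBr.
have := @sum_by_parts_le R n (fun i => p 0 i) (fun i => mu 0 i - y 0 i) 0.
rewrite mul0r; apply=> // k; rewrite sumrB subr_ge0.
have := prefix_sum_le y (minn k n) yF (geq_minr k n).
have prefE u : cube_sum u (prefix_cube n (minn k n)) =
    \sum_(i < n | (i < k)%N) u 0 i.
  by apply: eq_bigl => i; rewrite tnth_prefix leq_min ltn_ord andbT.
by rewrite !prefE.
Qed.

End Greedy.

(** * The revenue *)

Lemma revenue_eq (R : realType) (n : nat) (p q : 'rV[R]_n) (d : cube n -> R)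
    (r : R) :
  is_max (revenues p q d) r -> revenue p q d = r.
Proof.
move=> r_max; rewrite /revenue; case: xgetP => [s _ [sA s_ub]|/(_ r)//].
case: r_max => rA r_ub; apply/eqP.
by rewrite eq_le r_ub// s_ub.
Qed.

Theorem corollary2 (R : realType) (n : nat) (d : cube n -> R) (q p : 'rV[R]_n)
    (d_ge0 : forall x : cube n, 0 <= d x)
    (d_nondecreasing : nondecreasing_cube d)
    (d_submodular : submodular_cube d)
    (q_ge0 : forall i : 'I_n, 0 <= q 0 i)
    (p_ge0 : forall i : 'I_n, 0 <= p 0 i)
    (p_nonincreasing : forall i j : 'I_n, (i <= j)%N -> p 0 j <= p 0 i) :
  is_max (revenues p q d) (revenue p q d) /\
  revenue p q d = dotp (mu_star q d) p.
Proof.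
have mu_max : is_max (revenues p q d) (dotp p (mu_star q d)).
  split; first by exists (mu_star q d) => //; exact: mu_star_feasible.
  by move=> _ [y yF <-]; exact: mu_star_optimal.
rewrite (revenue_eq _ _ _ _ _ _ mu_max); split=> //.
by apply: eq_bigr => i _; rewrite mulrC.
Qed.
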